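(* Let $G$ be a connected $2$-edge-colored multigraph on $n\ge 9$ vertices with $m$ edges. If the rainbow degree of $G$ equals $2$ and $m\ge \binom{n}{2}+\binom{n-2}{2}+3$, then $G$ has a proper Hamiltonian cycle if $n$ is even, and a proper cycle of length $n-1$ if $n$ is odd.
   Context: A $c$-edge-colored multigraph has each edge colored with one color from $\{1,\dots,c\}$, and no two edges joining the same pair of vertices have the same color (no loops); $m$ counts all edges including parallel ones. Throughout, multigraphs are assumed connected. The rainbow degree of a vertex is the number of distinct colors on edges incident to it; the rainbow degree of the multigraph is the minimum over its vertices. A subgraph is proper if any two adjacent edges in it have different colors. A proper Hamiltonian cycle is a properly colored cycle through all vertices; the length of a cycle is its number of vertices. *)

(* Defs.v *)
From mathcomp Require Import all_boot.

Set Implicit Arguments.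
Unset Strict Implicit.
Unset Printing Implicit Defensive.

(* An edge is a pair (ends, colour) with a two-element set of ends. Taking a
   *set* of such pairs allows parallel edges, but not two parallel edges of the
   same colour, and the cardinality counts parallel edges separately. *)
Record cmultigraph (c : nat) (V : finType) := CMultigraph {
  edges : {set {set V} * 'I_c};
  edges_loopless : forall e, e \in edges -> #|e.1| = 2
}.

Section ColoredMultigraph.
Variables (c : nat) (V : finType).
Implicit Types (G : cmultigraph c V) (F : {set {set V} * 'I_c}).
Implicit Types (s : seq (V * 'I_c)).

Definition adjacent G : rel V :=
  [rel x y | [exists i : 'I_c, ([set x; y], i) \in edges G]].

Definition connected G : Prop := forall x y : V, connect (adjacent G) x y.

Definition vertex_rainbow_degree G (x : V) : nat :=
  #|[set e.2 | e in edges G & x \in e.1]|.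

(* Every vertex has rainbow degree at most c, so the default value c of the
   iterated minimum only matters when V is empty. *)
Definition rainbow_degree G : nat :=
  \big[minn/c]_(x : V) vertex_rainbow_degree G x.

Definition proper F : Prop :=
  forall e f, e \in F -> f \in F -> e != f ->
    ~~ [disjoint e.1 & f.1] -> e.2 != f.2.

(* A closed walk is encoded as the cyclic sequence of its vertices, each paired
   with the colour of the edge leading to the cyclically next vertex. *)
Definition walk_edges s : {set {set V} * 'I_c} :=
  [set ([set p.1; (next s p).1], p.2) | p in s].

(* The last conjunct, which asks for as many edges as vertices, is automatic
   when size s > 2; for size s = 2 it asks for two distinct parallel edges. *)
Definition is_cycle G s : bool :=
  [&& 1 < size s, uniq [seq p.1 | p <- s], walk_edges s \subset edges G
    & #|walk_edges s| == size s].

Definition has_proper_cycle G (k : nat) : Prop :=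
  exists s, [/\ is_cycle G s, size s = k & proper (walk_edges s)].

Definition has_proper_hamiltonian_cycle G : Prop :=
  exists s, [/\ is_cycle G s, forall x : V, x \in [seq p.1 | p <- s]
              & proper (walk_edges s)].

End ColoredMultigraph.

(* Main.v *)
Require Import Defs.
From mathcomp Require Import all_boot.
From mathcomp Require Import zify.

Set Implicit Arguments.
Unset Strict Implicit.
Unset Printing Implicit Defensive.

(** At most 2n - 6 edges of the complete 2-coloured multigraph are missing.
    Suppose that removing two vertices x and y leaves a graph with an
    alternating Hamiltonian cycle. If xy has colour c, it can replace an edge
    ab of the other colour c' as a, x, y, b or as a, y, x, b. If this fails for
    each of the n/2 - 1 edges of colour c' of the cycle, then each of them
    accounts for two missing edges of colour c' between {x, y} and {a, b}; so
    the insertion succeeds when fewer than n - 2 edges of colour c' are missing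
    between {x, y} and the rest.

    With at most n - 2 missing edges this gives an induction without any degree
    condition. In general, a vertex with only one or two edges of some colour
    absorbs so many missing edges that removing it reduces to the sparse case;
    otherwise one removes two vertices that meet many missing edges, and every
    colour is still present at every remaining vertex. For odd n, one first
    deletes a vertex meeting many missing edges. *)

(** * The two colours *)

Lemma rev_ord2_neq (i : 'I_2) : rev_ord i != i.
Proof. by case: i => [[|[|]]]. Qed.

Lemma neq_rev_ord2 (i j : 'I_2) : i != j -> i = rev_ord j.
Proof.
by move: i j => [[|[|//]] ?] [[|[|//]] ?] // _; apply: val_inj.
Qed.

Lemma sum_ord2 (F : 'I_2 -> nat) (i : 'I_2) :
  \sum_j F j = F i + F (rev_ord i).
Proof.
rewrite (bigD1 i) //= (bigD1 (rev_ord i)) ?rev_ord2_neq //= big1 ?addn0 //.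
by move=> j /andP[/neq_rev_ord2 -> /eqP].
Qed.

Lemma map_uniq_inj (T U : eqType) (f : T -> U) (s : seq T) :
  uniq (map f s) -> {in s &, injective f}.
Proof.
elim: s => [|a s IH] //= /andP[fa us] x y; rewrite !inE.
case/predU1P=> [->|xs] /predU1P[->|ys] // e; last exact: IH.
- by rewrite e map_f in fa.
- by rewrite -e map_f in fa.
Qed.

(** * Alternating cycles as proper cycles *)

Section AlternatingCycles.
Variables (V : finType) (G : cmultigraph 2 V).
Implicit Types (i c : 'I_2) (x y z v : V) (S : {set V}) (s : seq (V * 'I_2)).

Definition edge i x y := ([set x; y], i) \in edges G.

Lemma edgeC i x y : edge i x y = edge i y x.
Proof. by rewrite /edge setUC. Qed.

Lemma edge_irr i x : edge i x x = false.
Proof.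
apply/negP => /edges_loopless /=; by rewrite setUid cards1.
Qed.

(** With two colours, properness of a cycle becomes a condition on cyclically consecutive entries,
    in the same encoding as [is_cycle]. *)
Definition alt_step : rel (V * 'I_2) :=
  [rel p q | (q.2 == rev_ord p.2) && edge p.2 p.1 q.1].

Definition alternating_on S : Prop :=
  exists s, [/\ cycle alt_step s, uniq [seq p.1 | p <- s]
              & [seq p.1 | p <- s] =i S].

(** The edges entering and leaving a vertex of the cycle differ in colour, so a cycle edge is
    determined by its colour and one end. This yields both properness and the number of distinct
    edges, also on two vertices. *)
Lemma alternating_walk_inj s p q :
  cycle alt_step s -> uniq [seq r.1 | r <- s] -> p \in s -> q \in s ->
  p.2 = q.2 -> ~~ [disjoint [set p.1; (next s p).1] & [set q.1; (next s q).1]] ->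
  p = q.
Proof.
move=> cs us ps qs pq.
have inj (u v : V * 'I_2) : u \in s -> v \in s -> u.1 = v.1 -> u = v.
  by move=> us' vs' e; exact: (map_uniq_inj us).
have no (u v : V * 'I_2) : u \in s -> v \in s -> u.2 = v.2 -> u.1 != (next s v).1.
  move=> us' vs' uv; apply/eqP => e.
  have {}e : u = next s v by apply: inj; rewrite ?mem_next.
  have /andP[/eqP] := next_cycle cs vs'.
  by rewrite -e uv => h; have := rev_ord2_neq v.2; rewrite -h eqxx.
rewrite -setI_eq0 => /set0Pn[v]; rewrite !inE.
case/andP=> /orP[] /eqP -> /orP[] /eqP e.
- exact: inj.
- by have := no _ _ ps qs pq; rewrite e eqxx.
- by have := no _ _ qs ps (esym pq); rewrite e eqxx.
- have {}e : next s p = next s q by apply: inj; rewrite ?mem_next.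
  by rewrite -(prev_next (map_uniq us) p) e prev_next // (map_uniq us).
Qed.

Lemma alternating_proper_cycle S : 1 < #|S| -> alternating_on S ->
  exists s, [/\ is_cycle G s, size s = #|S|, [seq p.1 | p <- s] =i S
              & Defs.proper (walk_edges s)].
Proof.
move=> S1 [s [cs us sS]].
have szS : size s = #|S|.
  by rewrite -(eq_card sS) (card_uniqP us) size_map.
exists s; split=> //; last first.
  move=> _ _ /imsetP[p ps ->] /imsetP[q qs ->] /= ne dj.
  apply/negP => /eqP pq; have e := alternating_walk_inj cs us ps qs pq dj.
  by rewrite e eqxx in ne.
rewrite /is_cycle szS S1 us /=; apply/andP; split.
  apply/subsetP => _ /imsetP[p ps ->].
  by have /andP[] := next_cycle cs ps.
rewrite card_in_imset; first by rewrite -szS (card_uniqP (map_uniq us)).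
move=> p q ps qs [e pq]; apply: (alternating_walk_inj cs us ps qs pq).
by rewrite e -setI_eq0 setIid; apply/set0Pn; exists q.1; rewrite !inE eqxx.
Qed.

(** * Counting missing edges *)

Definition missing i x y : bool := (x != y) && ~~ edge i x y.
Definition missing_mult x y : nat := \sum_i missing i x y.
Definition missing_cdeg i S x : nat := \sum_(y in S) missing i x y.
Definition missing_deg S x : nat := \sum_i missing_cdeg i S x.
(** Each missing edge is counted from both ends; the recurring bound
    [missing_size S + 12 <= 4 * #|S|] thus allows 2|S| - 6 missing edges. *)
Definition missing_size S : nat := \sum_(x in S) missing_deg S x.

Lemma missingC i x y : missing i x y = missing i y x.
Proof. by rewrite /missing eq_sym edgeC. Qed.

Lemma missing_multC x y : missing_mult x y = missing_mult y x.
Proof. by apply: eq_bigr => i _; rewrite missingC. Qed.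

Lemma missingxx i x : missing i x x = false.
Proof. by rewrite /missing eqxx. Qed.

Lemma missing_multxx x : missing_mult x x = 0.
Proof. by apply: big1 => i _; rewrite missingxx. Qed.

Lemma missing_mult_col i x y :
  missing_mult x y = missing i x y + missing (rev_ord i) x y.
Proof. exact: (sum_ord2 (fun j => missing j x y : nat)). Qed.

Lemma missing_deg_col i S x :
  missing_deg S x = missing_cdeg i S x + missing_cdeg (rev_ord i) S x.
Proof. exact: (sum_ord2 (fun j => missing_cdeg j S x)). Qed.

Lemma missing_degE S x : missing_deg S x = \sum_(y in S) missing_mult x y.
Proof. by rewrite /missing_deg exchange_big. Qed.

Lemma missing_cdegD1 i S x y : y \in S ->
  missing_cdeg i S x = missing i x y + missing_cdeg i (S :\ y) x.
Proof. exact: big_setD1. Qed.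

Lemma missing_degD1 S x y : y \in S ->
  missing_deg S x = missing_mult x y + missing_deg (S :\ y) x.
Proof. by move=> yS; rewrite !missing_degE; apply: big_setD1. Qed.

Lemma missing_sizeD1 S x : x \in S ->
  missing_size S = missing_size (S :\ x) + (missing_deg S x).*2.
Proof.
move=> xS; rewrite /missing_size (big_setD1 x) //=.
rewrite (eq_bigr (fun y => missing_mult y x + missing_deg (S :\ x) y)).
  rewrite big_split /= -addnn (missing_degD1 x xS) missing_multxx add0n.
  rewrite (eq_bigr (missing_mult x)) => [|y _]; last exact: missing_multC.
  by rewrite -missing_degE; lia.
by move=> y _; apply: missing_degD1.
Qed.

Lemma missing_degD2 S x y : x \in S -> y \in S -> x != y ->
  missing_deg S x = missing_mult x y + missing_deg (S :\ x :\ y) x.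
Proof.
move=> xS yS xy; rewrite (missing_degD1 x xS) missing_multxx.
by apply: missing_degD1; rewrite !inE eq_sym xy.
Qed.

Lemma missing_sizeD2 S x y : x \in S -> y \in S -> x != y ->
  missing_size S = missing_size (S :\ x :\ y) +
    (missing_mult x y + missing_deg (S :\ x :\ y) x
       + missing_deg (S :\ x :\ y) y).*2.
Proof.
move=> xS yS xy; rewrite (missing_sizeD1 xS) (missing_degD2 xS yS xy).
rewrite (@missing_sizeD1 (S :\ x) y) ?inE 1?eq_sym ?xy //.
rewrite (@missing_degD1 (S :\ x) y y) ?inE 1?eq_sym ?xy //.
by rewrite missing_multxx; lia.
Qed.

Lemma missing_size_even S : ~~ odd (missing_size S).
Proof.
move: {2}#|S| (leqnn #|S|) => k; elim: k S => [|k IH] S.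
  by rewrite leqn0 cards_eq0 => /eqP ->; rewrite /missing_size big_set0.
move=> Sk; case: (set_0Vmem S) => [->|[x xS]].
  by rewrite /missing_size big_set0.
rewrite (missing_sizeD1 xS) oddD odd_double addbF; apply: IH.
by move: Sk; rewrite (cardsD1 x S) xS.
Qed.

Lemma not_missing i x y : x != y -> missing i x y = false -> edge i x y.
Proof. by rewrite /missing => -> /= /negbFE. Qed.

(** * Inserting an edge into an alternating cycle *)

Lemma insert_edge S x y c : x \in S -> y \in S -> edge c x y ->
  alternating_on (S :\ x :\ y) ->
  missing_cdeg (rev_ord c) (S :\ x :\ y) x
    + missing_cdeg (rev_ord c) (S :\ x :\ y) y < #|S :\ x :\ y| ->
  alternating_on S.
Proof.
move=> xS yS exy [s [cs us sS']]; set S' := S :\ x :\ y in sS' *.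
set c' := rev_ord c; move=> small.
have xy : x != y by apply: contraTneq exy => ->; rewrite edge_irr.
have nxt p : p \in s -> (next s p).2 = rev_ord p.2.
  by move=> /(next_cycle cs) /andP[/eqP].
(* [next] permutes the entries and swaps the colours, so edges of colour [c] start where those of
   colour [c'] end. *)
have reindex (F : V -> nat) :
    \sum_(p <- s | p.2 == c) F p.1 = \sum_(p <- s | p.2 == c') F (next s p).1.
  have pm : perm_eq s [seq next s p | p <- s].
    apply: uniq_perm; rewrite ?(map_uniq us) //.
      rewrite map_inj_uniq ?(map_uniq us) //.
      exact: can_inj (prev_next (map_uniq us)).
    move=> p; apply/idP/mapP => [ps|[q qs ->]]; last by rewrite mem_next.
    exists (prev s p); first by rewrite mem_prev.
    by rewrite next_prev // (map_uniq us).
  rewrite (perm_big _ pm) big_map big_seq_cond [RHS]big_seq_cond.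
  apply: eq_bigl => p; case ps: (p \in s) => //=.
  by rewrite (nxt _ ps) /c' (can2_eq rev_ordK rev_ordK).
(* The cycle edges of colour [c'] form a perfect matching of [S']. *)
have sumS (F : V -> nat) : \sum_(v in S') F v =
    \sum_(p <- s | p.2 == c') (F p.1 + F (next s p).1).
  rewrite big_split /= -reindex -(eq_bigl _ _ sS') -big_uniq //= big_map.
  rewrite (bigID (fun p => p.2 == c')) /=; congr (_ + _); apply: eq_bigl => p.
  apply/idP/eqP => [/neq_rev_ord2 ->|->]; first by rewrite rev_ordK.
  by rewrite eq_sym rev_ord2_neq.
have {small} [p ps /andP[/eqP pc ins]] : exists2 p, p \in s &
    (p.2 == c') && ((~~ missing c' x p.1 && ~~ missing c' y (next s p).1)
                || (~~ missing c' y p.1 && ~~ missing c' x (next s p).1)).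
  (* If neither orientation fits at a matching edge ab, two of xa, yb, ya, xb are missing in [c'],
     which sums to |S'| over the matching. *)
  apply/hasP; apply: contraLR small => /hasPn none.
  rewrite -leqNgt -sum1_card /missing_cdeg -big_split /= !sumS.
  rewrite big_seq_cond [X in _ <= X]big_seq_cond; apply: leq_sum => p /andP[ps pc].
  by move: (none p ps); rewrite pc /=; do 4 case: missing.
(* Exchanging x and y exchanges the two orientations. *)
wlog {ins}/andP[mx my] : x y xS yS exy xy @S' sS' sumS /
    ~~ missing c' x p.1 && ~~ missing c' y (next s p).1.
  move=> H; case/orP: ins => h; first exact: (H x y).
  apply: (H y x) => //; rewrite 1?edgeC 1?eq_sym //.
  - by move=> v; rewrite sS' !inE; case: (v == x); case: (v == y).
  - move=> F; rewrite -sumS; apply: eq_bigl => v.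
    by rewrite !inE; case: (v == x); case: (v == y).
have inS' q : q \in s -> q.1 \in S' by move=> qs; rewrite -sS' map_f.
have [i s' rs] := rot_to ps.
have us' : uniq [seq q.1 | q <- p :: s'] by rewrite -rs map_rot rot_uniq.
have cs' : cycle alt_step (p :: s') by rewrite -rs rot_cycle.
have nq : next s p = next (p :: s') p.
  by rewrite -rs next_rot // (map_uniq us).
have px : edge c' p.1 x.
  rewrite edgeC; apply: not_missing (negbTE mx).
  by have := inS' _ ps; rewrite !inE (eq_sym x) => /and3P[].
have qy : edge c' y (next s p).1.
  apply: not_missing (negbTE my).
  have /inS' : next s p \in s by rewrite mem_next.
  by rewrite !inE (eq_sym y) => /and3P[].
have memS q : (q \in [seq r.1 | r <- p :: s']) = (q \in S').
  by rewrite -rs map_rot mem_rot.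
(* The edge leaving [p] gives way to a path of three edges coloured [c'], [c], [c']. *)
exists [:: p, (x, c), (y, c') & s']; split.
- move: cs' qy; rewrite nq; case: s' {rs us' nq memS} => [|q s'] /=.
    rewrite andbT => /andP[/eqP h _]; have := rev_ord2_neq p.2.
    by rewrite -h => /eqP.
  rewrite eqxx => /andP[/andP[/eqP qc _] ->] qy.
  rewrite /alt_step /= pc qc pc /c' rev_ordK !eqxx /=.
  by rewrite -/c' px exy qy.
- have xn : x \notin [seq q.1 | q <- p :: s'] by rewrite memS !inE eqxx andbF.
  have yn : y \notin [seq q.1 | q <- p :: s'] by rewrite memS !inE eqxx.
  move: us' xn yn; rewrite /= !inE !negb_or.
  case/andP=> -> -> /andP[h1 ->] /andP[h2 ->].
  by rewrite (eq_sym p.1) h1 (eq_sym p.1) h2 xy.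
- move=> v; have := memS v; rewrite /= !inE => h.
  rewrite orbCA (orbCA (v == p.1)) h.
  case: (eqVneq v x) => [->|_]; first by rewrite xS.
  by case: (eqVneq v y) => [->|].
Qed.

Definition insertable S x y : Prop := exists2 c, edge c x y &
  missing_cdeg (rev_ord c) (S :\ x :\ y) x
    + missing_cdeg (rev_ord c) (S :\ x :\ y) y < #|S :\ x :\ y|.

Lemma insert_pair S x y : x \in S -> y \in S -> insertable S x y ->
  alternating_on (S :\ x :\ y) -> alternating_on S.
Proof. by move=> xS yS [c exy small] alt; apply: insert_edge small. Qed.

Lemma cardsD2 S x y : x \in S -> y \in S -> x != y ->
  #|S| = #|S :\ x :\ y|.+2.
Proof.
move=> xS yS xy; have yS' : y \in S :\ x by rewrite !inE eq_sym xy.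
by rewrite (cardsD1 x S) xS (cardsD1 y (S :\ x)) yS'.
Qed.

(** Both edges xy are present, and the smaller of the two colour counts is below |S'|. *)
Lemma insertable_double S x y : x != y -> missing_mult x y = 0 ->
  missing_deg (S :\ x :\ y) x + missing_deg (S :\ x :\ y) y
    < #|S :\ x :\ y|.*2 ->
  insertable S x y.
Proof.
move=> xy; rewrite (missing_mult_col ord0) => m0.
rewrite !(missing_deg_col ord0) => lt2.
have [lt1|ge1] := ltnP (missing_cdeg (rev_ord ord0) (S :\ x :\ y) x
    + missing_cdeg (rev_ord ord0) (S :\ x :\ y) y) #|S :\ x :\ y|.
  by exists ord0 => //; apply: not_missing => //; case: missing m0.
exists (rev_ord ord0); last by rewrite rev_ordK; lia.
by apply: not_missing => //; case: (missing (rev_ord _)) m0; rewrite ?addn1.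
Qed.

Lemma insertable_single S x y : x != y -> missing_mult x y <= 1 ->
  missing_deg (S :\ x :\ y) x + missing_deg (S :\ x :\ y) y < #|S :\ x :\ y| ->
  insertable S x y.
Proof.
move=> xy m1 lt.
have [c mc] : exists c, missing c x y = false.
  move: m1; rewrite (missing_mult_col ord0).
  by case m: (missing ord0 x y); case m': (missing _ x y) => // _;
     [exists (rev_ord ord0) | exists ord0 | exists ord0].
by exists c; [exact: not_missing | move: lt; rewrite !(missing_deg_col c); lia].
Qed.

Lemma missing_mult_le2 x y : missing_mult x y <= 2.
Proof. by rewrite (missing_mult_col ord0); do 2 case: missing. Qed.

Lemma missing_mult_le S x y : y \in S -> missing_mult x y <= missing_deg S x.
Proof. by move=> yS; rewrite (missing_degD1 x yS) leq_addr. Qed.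

Lemma max_missing_deg S : S != set0 ->
  exists2 x, x \in S & forall y, y \in S -> missing_deg S y <= missing_deg S x.
Proof.
case/set0Pn=> x0 x0S; pose x := [arg max_(x > x0 in S) missing_deg S x].
by exists x; rewrite /x; case: arg_maxnP.
Qed.

Lemma missing_deg_single S x : x \in S -> missing_deg S x < #|S|.-1.*2 ->
  exists y, [/\ y \in S, x != y & missing_mult x y <= 1].
Proof.
move=> xS lt; have [/existsP[y /and3P[]]|none] :=
  boolP [exists y, [&& y \in S, x != y & missing_mult x y <= 1]].
  by exists y.
move: lt; rewrite (cardsD1 x) xS (missing_degD1 x xS) missing_multxx add0n /=.
rewrite ltnNge -muln2 missing_degE.
case/negP; rewrite (eq_bigr (fun=> 2)) ?sum_nat_const // => y.
rewrite 2!inE => /andP[yx yS]; apply/eqP; rewrite eqn_leq missing_mult_le2 /=.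
rewrite ltnNge; apply: contra none => le1; apply/existsP; exists y.
by rewrite yS eq_sym yx.
Qed.

(** * The sparse case *)

(** Induction: if all |S| - 2 permitted edges are missing, the deleted pair has to meet two of
    them. *)
Lemma alternating_sparse S : ~~ odd #|S| -> 2 <= #|S| ->
  missing_size S <= (#|S| - 2).*2 -> alternating_on S.
Proof.
move: {2}#|S| (leqnn #|S|) => k; elim: k S => [|k IH] S; first by lia.
move=> Sk ev S2 sparse.
have [/eqP|S4] := eqVneq #|S| 2.
  case/cards2P=> x [y [xy eS]].
  have [xS yS] : x \in S /\ y \in S by rewrite eS !inE !eqxx orbT.
  have m0 : missing_mult x y = 0.
    have := missing_sizeD1 xS; have := missing_mult_le x yS.
    by move: sparse; rewrite eS cards2 xy; lia.
  have e c : edge c x y.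
    apply: not_missing => //; move: m0; rewrite (missing_mult_col c).
    by case: missing.
  exists [:: (x, ord0); (y, rev_ord ord0)]; split => /=.
  - by rewrite /alt_step /= e edgeC e !andbT.
  - by rewrite inE xy.
  - by move=> v; rewrite eS !inE.
suff [x [y [xS yS xy ins le]]] : exists x y, [/\ x \in S, y \in S, x != y,
    insertable S x y & missing_size (S :\ x :\ y) <= (#|S| - 4).*2].
  apply: (insert_pair xS yS ins); move: (cardsD2 xS yS xy) => c2.
  by apply: IH; lia.
have S0 : S != set0 by rewrite -card_gt0; lia.
have [x xS maxx] := max_missing_deg S0.
(* The bound on all missing edges already makes the pair insertable: with both edges xy there is
   ample room, and otherwise one missing edge is spent on xy itself. *)
have reduce y : y \in S -> x != y -> missing_mult x y <= 1 ->
    missing_size (S :\ x :\ y) <= (#|S| - 4).*2 ->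
  exists x y, [/\ x \in S, y \in S, x != y,
    insertable S x y & missing_size (S :\ x :\ y) <= (#|S| - 4).*2].
  move=> yS xy m1 le; exists x, y; split=> //.
  move: (missing_sizeD2 xS yS xy) (cardsD2 xS yS xy) => e2 c2.
  case m: (missing_mult x y) m1 => [|[|//]] _.
    by apply: insertable_double => //; lia.
  by apply: insertable_single; rewrite ?m //; lia.
have e1 := missing_sizeD1 xS.
have [y [yS xy m1]] : exists y, [/\ y \in S, x != y & missing_mult x y <= 1].
  by apply: missing_deg_single => //; lia.
(* Deleting x suffices if it meets two missing edges, or if none is missing. If x meets exactly one,
   y is chosen to meet another one, if any is left. *)
case Dx: (missing_deg S x == 1); last first.
  apply: (reduce y) => //; move: (missing_sizeD2 xS yS xy) => e2.
  have := missing_degD2 xS yS xy.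
  case: (ltnP 1 (missing_deg S x)) => [|D1]; first by lia.
  suff : missing_size S = 0 by lia.
  by apply: big1 => z zS; have := maxx z zS; lia.
have yS' : y \in S :\ x by rewrite !inE eq_sym xy.
case: (posnP (missing_size (S :\ x))) => [W0|Wpos].
  by apply: (reduce y) => //; have := missing_sizeD1 yS'; lia.
have S'0 : S :\ x != set0 by apply/set0Pn; exists y.
have {y yS xy m1 yS'} [y yS' maxy] := max_missing_deg S'0.
have /andP[yx yS] : (y != x) && (y \in S) by move: yS'; rewrite !inE.
have xy : x != y by rewrite eq_sym.
have Dy : 0 < missing_deg (S :\ x) y.
  rewrite lt0n; apply: contraTneq Wpos => Dy; rewrite -leqNgt leqn0.
  by rewrite /missing_size big1 // => z /maxy; rewrite Dy leqn0 => /eqP.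
apply: (reduce y) => //; first by have := missing_mult_le x yS; lia.
by have := missing_sizeD1 yS'; lia.
Qed.

(** * Reduction steps: colour neighbourhoods, vertices of low colour degree, heavy pairs *)

Lemma sum_edge_missing i S x : x \in S ->
  \sum_(y in S) edge i x y + missing_cdeg i S x = #|S|.-1.
Proof.
move=> xS; rewrite -big_split /= (big_setD1 x) //= missingxx edge_irr add0n.
rewrite (eq_bigr (fun=> 1)) ?sum1_card; first by rewrite (cardsD1 x S) xS.
by move=> y; rewrite !inE /missing eq_sym => /andP[-> _]; case: edge.
Qed.

Lemma edge_neighbours i S x : x \in S ->
  #|[set y in S | edge i x y]| + missing_cdeg i S x = #|S|.-1.
Proof.
move/(sum_edge_missing i) <-; congr (_ + _); rewrite -sum1_card big_mkcond /=.
rewrite [RHS]big_mkcond; apply: eq_bigr => y _; rewrite inE.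
by case: (y \in S); case: edge.
Qed.

Lemma missing_cdeg_sub i S x y : missing_cdeg i (S :\ y) x <= missing_cdeg i S x.
Proof.
case: (boolP (y \in S)) => [/(missing_cdegD1 i x) ->|yS]; first exact: leq_addl.
have -> : S :\ y = S; last by [].
by apply/setDidPl; rewrite disjoint_sym disjoints1.
Qed.

Lemma missing_deg_sub S x y : missing_deg (S :\ y) x <= missing_deg S x.
Proof. by apply: leq_sum => i _; apply: missing_cdeg_sub. Qed.

(** Let c be a colour missing at x at least as often as the other. If two c-neighbours y1, y2 both
    fail, the edges missing at x, y1 and y2 number at least 2(|S| - 2) - 1, where the 1 accounts for
    y1y2 being counted twice; this exceeds 2|S| - 6. *)
Lemma insertable_partner S x : x \in S -> missing_size S + 12 <= 4 * #|S| ->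
  (forall i, missing_cdeg i S x + 2 < #|S|) ->
  exists y, [/\ y \in S, x != y & insertable S x y].
Proof.
move=> xS WS deg2.
have [c le_c] : exists c, missing_cdeg (rev_ord c) S x <= missing_cdeg c S x.
  case: (leqP (missing_cdeg (rev_ord ord0) S x) (missing_cdeg ord0 S x)) => h.
    by exists ord0.
  by exists (rev_ord ord0); rewrite rev_ordK ltnW.
have /card_gt1P[y1 [y2 []]] : 1 < #|[set y in S | edge c x y]|.
  by have := edge_neighbours c xS; have := deg2 c; lia.
rewrite !inE => /andP[y1S e1] /andP[y2S e2] y12.
have [xy1 xy2] : x != y1 /\ x != y2.
  by split; [move: e1|move: e2]; apply: contraTneq => <-; rewrite edge_irr.
set c' := rev_ord c in le_c.
have [ok1|no1] := ltnP (missing_cdeg c' (S :\ x :\ y1) x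
    + missing_cdeg c' (S :\ x :\ y1) y1) #|S :\ x :\ y1|.
  by exists y1; split=> //; exists c.
have [ok2|no2] := ltnP (missing_cdeg c' (S :\ x :\ y2) x
    + missing_cdeg c' (S :\ x :\ y2) y2) #|S :\ x :\ y2|.
  by exists y2; split=> //; exists c.
have [y1S' y2S'] : y1 \in S :\ x /\ y2 \in S :\ x.
  by rewrite !inE !(eq_sym _ x) xy1 xy2.
have sub y : missing_cdeg c' (S :\ x :\ y) x <= missing_cdeg c' S x.
  exact: leq_trans (missing_cdeg_sub _ _ _ _) (missing_cdeg_sub _ _ _ _).
have := sub y1; have := sub y2.
have d1 : missing_cdeg c' (S :\ x :\ y1) y1 =
    missing c' y1 y2 + missing_cdeg c' (S :\ x :\ y1 :\ y2) y1.
  by apply: missing_cdegD1; rewrite !inE !(eq_sym _ x) xy2 eq_sym y12.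
have d2 : missing_cdeg c' (S :\ x :\ y2) y2 =
    missing c' y1 y2 + missing_cdeg c' (S :\ x :\ y1 :\ y2) y2.
  rewrite missingC (_ : S :\ x :\ y1 :\ y2 = S :\ x :\ y2 :\ y1).
    by apply: missing_cdegD1; rewrite !inE !(eq_sym _ x) xy1 y12.
  by rewrite !setDDl (setUC [set y1]) .
have := missing_sizeD1 xS; have := missing_sizeD2 y1S' y2S' y12.
rewrite (missing_mult_col c') !(missing_deg_col c') {2}/c' rev_ordK.
move: (cardsD2 xS y1S xy1) (cardsD2 xS y2S xy2).
rewrite {}d1 {}d2 in no1 no2 *; move: (leq_b1 (missing c' y1 y2)) no1 no2.
move: (nat_of_bool (missing c' y1 y2)) => m m1 no1 no2.
by clear sub e1 e2 xS y1S y2S deg2 xy1 xy2 y1S' y2S' y12; lia.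
Qed.

(** The vertex x has a single neighbour z in colour i and misses |S| - 2 edges to the rest. At most
    |S| - 4 others are missing, few enough both to insert xz and to apply the sparse case to the
    rest. *)
Lemma alternating_leaf S i x : ~~ odd #|S| -> 3 < #|S| -> x \in S ->
  missing_size S + 12 <= 4 * #|S| -> missing_cdeg i S x + 2 = #|S| ->
  alternating_on S.
Proof.
move=> ev S3 xS WS leaf.
have /card_gt0P[z] : 0 < #|[set y in S | edge i x y]|.
  by have := edge_neighbours i xS; lia.
rewrite !inE => /andP[zS exz].
have xz : x != z by apply: contraTneq exz => ->; rewrite edge_irr.
have dx : missing_cdeg i S x = missing_cdeg i (S :\ x :\ z) x.
  rewrite (missing_cdegD1 i x xS) missingxx.
  rewrite (@missing_cdegD1 i (S :\ x) x z) ?inE 1?eq_sym ?xz //.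
  by rewrite /missing exz andbF.
move: (missing_sizeD2 xS zS xz) (cardsD2 xS zS xz) => e2 c2.
rewrite !(missing_deg_col i) in e2.
apply: (insert_pair xS zS); first by exists i => //; lia.
by apply: alternating_sparse; lia.
Qed.

Lemma missing_size_le S x e : x \in S -> e <= missing_deg S x ->
  (forall y, y \in S -> missing_deg S y <= missing_deg S x) ->
  (forall y, y \in S -> x != y -> missing_mult x y = 0 -> missing_deg S y <= e) ->
  missing_size S <= missing_deg S x + #|S|.-1 * e
                    + missing_deg S x * (missing_deg S x - e).
Proof.
move=> xS eD maxx far; set D := missing_deg S x in eD maxx *.
rewrite /missing_size (big_setD1 x) //= -addnA leq_add2l.
have -> : #|S|.-1 = #|S :\ x| by rewrite (cardsD1 x S) xS.
have eDD : D = \sum_(y in S :\ x) missing_mult x y.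
  by rewrite /D missing_degE (big_setD1 x) //= missing_multxx.
rewrite -sum_nat_const {1}eDD big_distrl -big_split /=.
apply: leq_sum => y; rewrite !inE => /andP[yx yS].
have [m0|mpos] := posnP (missing_mult x y).
  by rewrite (leq_trans (far y yS _ m0)) ?leq_addr // eq_sym.
rewrite (leq_trans (maxx y yS)) // -{1}(subnKC eD) leq_add2l.
by rewrite leq_pmull.
Qed.

(** With |S| - 1 missing edges some vertex might lack a colour; u excludes this. In the tight case
    the deleted pair has to meet three missing edges. *)
Lemma alternating_near_sparse S u : ~~ odd #|S| -> 6 <= #|S| ->
  missing_size S <= (#|S| - 1).*2 -> u \in S -> missing_deg S u = 0 ->
  alternating_on S.
Proof.
move=> ev S6 WS uS u0; have evW := missing_size_even S.
have [sp|nsp] := leqP (missing_size S) (#|S| - 2).*2.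
  by apply: alternating_sparse => //; lia.
have reduce x y : x \in S -> y \in S -> x != y -> missing_mult x y = 0 ->
    3 <= missing_deg S x + missing_deg S y -> alternating_on S.
  move=> xS yS xy m0 D3.
  move: (missing_sizeD2 xS yS xy) (cardsD2 xS yS xy) (missing_degD2 xS yS xy).
  have := @missing_degD2 S y x yS xS; rewrite eq_sym (missing_multC y) => /(_ xy).
  have -> : S :\ y :\ x = S :\ x :\ y by rewrite !setDDl setUC.
  move=> ey ex e2 c2; apply: (insert_pair xS yS).
    by apply: insertable_double => //; lia.
  by apply: alternating_sparse; lia.
have S0 : S != set0 by rewrite -card_gt0; lia.
have [x xS maxx] := max_missing_deg S0.
have WD : missing_size S <= #|S| * missing_deg S x.
  by rewrite -sum_nat_const; apply: leq_sum.
have [D3|D2] := ltnP 2 (missing_deg S x).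
  apply: (reduce x u) => //; last by lia.
    by apply: contraTneq D3 => ->; rewrite u0.
  by apply/eqP; rewrite missing_multC -leqn0 -u0 missing_mult_le.
have [/existsP[y /and4P[yS xy /eqP m0 Dy]]|none] := boolP [exists y,
    [&& y \in S, x != y, missing_mult x y == 0 & 0 < missing_deg S y]].
  apply: (reduce x y) => //.
  by move: (missing_deg S x) D2 WD => [|[|[|//]]] _ WD; lia.
(* With maximum 2 and no such y this gives at most 2 + 2 * 2, below twice |S| - 1. *)
have : missing_size S <= missing_deg S x + #|S|.-1 * 0
                      + missing_deg S x * (missing_deg S x - 0).
  apply: missing_size_le => // y yS xy m0; rewrite leqNgt.
  apply: contra none => Dy; apply/existsP; exists y.
  by rewrite yS xy m0.
by move: (missing_deg S x) D2 WD => [|[|[|//]]] _ WD; lia.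
Qed.

(** As x misses |S| - 3 edges of colour i, deleting x and y leaves at most |S| - 3 missing edges.
    This is one too many for the sparse case, and equality forces y to miss nothing. *)
Lemma two_neighbours_step S i x y : ~~ odd #|S| -> 8 <= #|S| ->
  missing_size S + 12 <= 4 * #|S| -> missing_cdeg i S x + 3 = #|S| ->
  x \in S -> y \in S -> edge i x y ->
  [/\ x != y, insertable S x y, missing_size (S :\ x :\ y) <= (#|S| - 3).*2
    & alternating_on S \/ missing_deg S y = 0].
Proof.
move=> ev S8 WS two xS yS exy; have xy : x != y.
  by apply: contraTneq exy => ->; rewrite edge_irr.
have dx : missing_cdeg i S x = missing_cdeg i (S :\ x :\ y) x.
  rewrite (missing_cdegD1 i x xS) missingxx.
  rewrite (@missing_cdegD1 i (S :\ x) x y) ?inE 1?eq_sym ?xy //.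
  by rewrite /missing exy andbF.
move: (missing_sizeD2 xS yS xy) (cardsD2 xS yS xy) => W c2.
have := @missing_degD2 S y x yS xS; rewrite eq_sym (missing_multC y) => /(_ xy).
have -> : S :\ y :\ x = S :\ x :\ y by rewrite !setDDl setUC.
move=> Dy; rewrite (missing_deg_col i _ x) -dx in W.
have le_y : missing_cdeg (rev_ord i) (S :\ x :\ y) y <= missing_deg S y.
  by rewrite Dy (missing_deg_col i) addnA leq_addl.
have key : missing_size (S :\ x :\ y) + (missing_deg S y).*2
    + (missing_cdeg (rev_ord i) (S :\ x :\ y) x).*2 <= (#|S| - 3).*2.
  by move: W WS Dy two; clear; lia.
have ins : insertable S x y by exists i => //; move: le_y key c2 S8; clear; lia.
have evW := missing_size_even (S :\ x :\ y).
split=> //; first by move: key; clear; lia.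
have [sp|nsp] := leqP (missing_size (S :\ x :\ y)) (#|S| - 4).*2; last first.
  by right; move: nsp evW key S8; clear; lia.
left; apply: (insert_pair xS yS ins).
by apply: alternating_sparse; move: sp ev c2 S8; clear; lia.
Qed.

(** Unless one of the two neighbours already finishes, neither misses an edge, and the second one
    serves as u once x and the first are deleted. *)
Lemma alternating_two_neighbours S i x : ~~ odd #|S| -> 8 <= #|S| -> x \in S ->
  missing_size S + 12 <= 4 * #|S| -> missing_cdeg i S x + 3 = #|S| ->
  alternating_on S.
Proof.
move=> ev S8 xS WS two.
have /card_gt1P[y1 [y2 []]] : 1 < #|[set y in S | edge i x y]|.
  by have := edge_neighbours i xS; lia.
rewrite !inE => /andP[y1S e1] /andP[y2S e2] y12.
have [xy1 ins1 W1 [//|y10]] := two_neighbours_step ev S8 WS two xS y1S e1.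
have [xy2 _ _ [//|y20]] := two_neighbours_step ev S8 WS two xS y2S e2.
have c2 := cardsD2 xS y1S xy1.
have y2S' : y2 \in S :\ x :\ y1 by rewrite !inE eq_sym y12 eq_sym xy2.
apply: (insert_pair xS y1S ins1).
apply: (@alternating_near_sparse _ y2) => //;
  try by move: ev S8 W1 c2; clear; lia.
apply/eqP; rewrite -leqn0 -y20.
exact: leq_trans (missing_deg_sub _ _ _) (missing_deg_sub _ _ _).
Qed.

(* [missing_size] is twice the number of missing edges. [B] is the value that
   lets the induction go on with two vertices fewer: with ten vertices it is
   18 rather than 20, because K_8 minus a monochromatic K_5 misses ten edges
   and has no perfect matching in that colour, and with eight vertices it is
   what [alternating_sparse] needs on six. *)
Lemma insertable_heavy_pair S B : 8 <= #|S| -> missing_size S + 12 <= 4 * #|S| ->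
  (forall i x, x \in S -> missing_cdeg i S x + 2 < #|S|) ->
  [\/ [/\ #|S| = 8, B = 8 & missing_size S <= 18], #|S| = 10 /\ B = 18
    | 12 <= #|S| /\ B + 20 = 4 * #|S|] ->
  exists x y, [/\ x \in S, y \in S, x != y,
    insertable S x y & missing_size (S :\ x :\ y) <= B].
Proof.
move=> S8 WS deg2 SB.
have S0 : S != set0 by rewrite -card_gt0; lia.
have [x xS maxx] := max_missing_deg S0.
have [WB|WB] := leqP (missing_size S) (B + (missing_deg S x).*2).
  have [y [yS xy ins]] := insertable_partner xS WS (fun i => deg2 i x xS).
  exists x, y; split=> //; have := missing_sizeD2 xS yS xy.
  by have := missing_degD2 xS yS xy; lia.
have [/existsP[y /and4P[yS xy /eqP m0 Wy]]|none] := boolP [exists y,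
    [&& y \in S, x != y, missing_mult x y == 0
      & missing_size S <= B + (missing_deg S x + missing_deg S y).*2]].
  move: (missing_sizeD2 xS yS xy) (cardsD2 xS yS xy) => e2 c2.
  exists x, y; split=> //; first by apply: insertable_double => //; lia.
  have := missing_degD2 xS yS xy; have := missing_degD2 yS xS.
  rewrite eq_sym (missing_multC y) m0 (_ : S :\ y :\ x = S :\ x :\ y).
    by move=> /(_ xy); lia.
  by rewrite !setDDl setUC.
(* When no y qualifies, every vertex joined to x in both colours has small missing degree. The cases
   e = 0 and e = 1 leave only eight vertices with nine missing edges, four of them at x. *)
have bound e : e <= missing_deg S x ->
    missing_size S <= B + (missing_deg S x + e).*2.+2 ->
    missing_size S <= missing_deg S x + #|S|.-1 * e
                      + missing_deg S x * (missing_deg S x - e).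
  move=> eD We; apply: missing_size_le => // y yS xy m0; rewrite leqNgt.
  apply: contra none => ey; apply/existsP; exists y.
  by rewrite yS xy m0 /=; lia.
have [S8' [Dx [B8 W18]]] : #|S| = 8 /\ missing_deg S x = 4 /\ B = 8
    /\ missing_size S = 18.
  have bD : missing_size S <= #|S| * missing_deg S x.
    by rewrite -sum_nat_const; apply: leq_sum.
  move: (missing_size_even S) (bound 0) (bound 1) bD.
  rewrite addn0 subn0 muln0 addn0 muln1 leq0n => ev /(_ isT) b0 b1.
  move: (missing_deg S x) (missing_size S) #|S| WB WS ev b0 b1 S8 SB
    => {bound none xS maxx} D W N WB WS ev b0 b1 S8 SB bD.
  have D4 : D <= 4 by case: SB => [[]|[]|[]]; lia.
  case: SB => [[? ? W18]|[? ?]|[le12 e12]]; subst.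
  - move: D WB b0 b1 bD D4 => [|[|[|[|[|//]]]]]; lia.
  - move: D WB b0 b1 bD D4 => [|[|[|[|[|//]]]]]; lia.
  - move: D WB b0 b1 bD D4 => [|[|[|[|[|//]]]]]; lia.
have D_le y : y \in S -> x != y -> missing_deg S y <= 4 * missing_mult x y.
  move=> yS xy; have := maxx y yS; case m: (missing_mult x y) => [|k]; last by lia.
  move=> _; rewrite leqNgt; apply: contra none => Dy; apply/existsP; exists y.
  by rewrite yS xy m /=; lia.
have sum2 : \sum_(y in S :\ x) (4 * missing_mult x y - missing_deg S y) = 2.
  rewrite sumnB => [|y]; last by rewrite !inE eq_sym => /andP[xy yS]; apply: D_le.
  have := missing_degE S x; rewrite (big_setD1 x) //= missing_multxx Dx add0n => s4.
  move: W18; rewrite /missing_size (big_setD1 x) //= Dx -big_distrr /= -s4.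
  by lia.
(* A positive term of a sum equal to 2 excludes multiplicity 0, and multiplicity 2 would give a term
   of at least 4. With x, this y meets five or six of the nine missing edges. *)
have [y [yS xy m1 /andP[Dy2 Dy3]]] : exists y,
    [/\ y \in S, x != y, missing_mult x y = 1 & 2 <= missing_deg S y <= 3].
  have [y yS' y0] : exists2 y, y \in S :\ x
      & 0 < 4 * missing_mult x y - missing_deg S y.
    apply/exists_inP; apply: contraPT sum2 => /exists_inPn none0.
    by rewrite big1 // => y /none0; rewrite lt0n negbK => /eqP.
  move: sum2; rewrite (big_setD1 y) //= => sum2; exists y.
  have /andP[yx yS] : (y != x) && (y \in S) by move: yS'; rewrite !inE.
  have := D_le y yS; have := maxx y yS; have := missing_mult_le2 x y.
  by rewrite eq_sym yx; move=> m2 Dy /(_ isT) Dy'; split=> //; lia.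
move: (missing_sizeD2 xS yS xy) (cardsD2 xS yS xy) (missing_degD2 xS yS xy).
have yx : y != x by rewrite eq_sym.
have := missing_degD2 yS xS yx; rewrite (missing_multC y).
have -> : S :\ y :\ x = S :\ x :\ y by rewrite !setDDl setUC.
move=> ey ex e2 c2; exists x, y; split=> //; last by lia.
by apply: insertable_single => //; lia.
Qed.

(** * Even and odd vertex sets *)

(** Vertices with one or two neighbours in a colour are treated first; otherwise a heavy pair is
    deleted. On eight vertices the general bound would admit the ten missing edges of a
    monochromatic K_5, hence the extra hypothesis. *)
Lemma alternating_even S : ~~ odd #|S| -> 8 <= #|S| ->
  missing_size S + 12 <= 4 * #|S| -> (#|S| = 8 -> missing_size S <= 18) ->
  (forall i x, x \in S -> missing_cdeg i S x + 1 < #|S|) -> alternating_on S.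
Proof.
move: {2}#|S| (leqnn #|S|) => k; elim: k S => [|k IH] S; first by lia.
move=> Sk ev S8 WS W18 deg1.
have [/existsP[i /exists_inP[x xS /eqP leaf]]|noleaf] :=
  boolP [exists i, exists x in S, missing_cdeg i S x + 2 == #|S|].
  by apply: alternating_leaf leaf => //; lia.
have [/existsP[i /exists_inP[x xS /eqP two]]|notwo] :=
  boolP [exists i, exists x in S, missing_cdeg i S x + 3 == #|S|].
  by apply: alternating_two_neighbours two.
have deg2 i x : x \in S -> missing_cdeg i S x + 2 < #|S|.
  move=> xS; have := deg1 i x xS; rewrite !addnS addn0 => d1.
  rewrite ltn_neqAle d1 andbT; apply: contra noleaf => /eqP e.
  by apply/existsP; exists i; apply/exists_inP; exists x; rewrite // -e addn2.
pose B := if #|S| == 8 then 8 else if #|S| == 10 then 18 else 4 * #|S| - 20.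
have [|x [y [xS yS xy ins le]]] := @insertable_heavy_pair S B S8 WS deg2.
  rewrite /B; case: eqP => [e8|n8]; first by constructor 1; split=> //; apply: W18.
  by case: eqP => n10; [constructor 2 | constructor 3; lia].
apply: (insert_pair xS yS ins); have c2 := cardsD2 xS yS xy.
have [e8|n8] := eqVneq #|S| 8.
  by apply: alternating_sparse; move: le; rewrite /B e8 /=; lia.
move: le; rewrite /B (negbTE n8) => le.
have W' : missing_size (S :\ x :\ y) + 12 <= 4 * #|S :\ x :\ y| /\
    (#|S :\ x :\ y| = 8 -> missing_size (S :\ x :\ y) <= 18).
  by case: eqP le; lia.
apply: IH; [lia | lia | lia | by case: W' | by case: W' |].
(* Three neighbours in each colour before the deletion leave at least one after it. *)
move=> i z; rewrite !inE => /and3P[_ _ zS].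
have := leq_trans (missing_cdeg_sub i (S :\ x) z y) (missing_cdeg_sub i S z x).
have : missing_cdeg i S z + 3 != #|S|.
  apply: contra notwo => e; apply/existsP; exists i.
  by apply/exists_inP; exists z.
by have := deg2 i z zS; lia.
Qed.

(** Deleting a vertex with one neighbour in some colour removes |S| - 2 missing edges, so the rest
    is sparse. If there is none, any deletion preserves both colours at every vertex, and one of
    maximal missing degree is deleted. *)
Lemma alternating_odd S : odd #|S| -> 9 <= #|S| ->
  missing_size S + 12 <= 4 * #|S| ->
  (forall i x, x \in S -> missing_cdeg i S x + 1 < #|S|) ->
  exists2 v, v \in S & alternating_on (S :\ v).
Proof.
move=> od S9 WS deg1.
have cD v : v \in S -> #|S| = #|S :\ v|.+1 by move=> vS; rewrite (cardsD1 v) vS.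
have [/existsP[i /exists_inP[x xS /eqP leaf]]|noleaf] :=
  boolP [exists i, exists x in S, missing_cdeg i S x + 2 == #|S|].
  exists x => //; have := cD x xS; have := missing_sizeD1 xS.
  by rewrite (missing_deg_col i) => W c; apply: alternating_sparse; lia.
have deg2 i x : x \in S -> missing_cdeg i S x + 2 < #|S|.
  move=> xS; have := deg1 i x xS; rewrite !addnS addn0 => d1.
  rewrite ltn_neqAle d1 andbT; apply: contra noleaf => /eqP e.
  by apply/existsP; exists i; apply/exists_inP; exists x; rewrite // -e addn2.
have S0 : S != set0 by rewrite -card_gt0; lia.
have [v vS maxv] := max_missing_deg S0.
have W_le : missing_size S <= #|S| * missing_deg S v.
  by rewrite -sum_nat_const; apply: leq_sum.
exists v => //; have := cD v vS; have := missing_sizeD1 vS => W c.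
have deg1' i x : x \in S :\ v -> missing_cdeg i (S :\ v) x + 1 < #|S :\ v|.
  rewrite !inE => /andP[_ xS].
  by have := missing_cdeg_sub i S x v; have := deg2 i x xS; lia.
(* The remaining eight vertices may miss nine edges: of at most twelve, v meets three, or else the
   maximum 2 leaves at most nine in all. *)
have [S9'|n9] := eqVneq #|S| 9.
  by rewrite S9' in W_le c WS; apply: alternating_even; lia || exact: deg1'.
(* The bound for |S| - 1 vertices is two edges lower; if the deletion has to supply more than one of
   them, v meets two, as a maximum of 1 would give at most |S| / 2 missing edges. *)
have D2 : 4 * #|S| <= missing_size S + 15 -> 2 <= missing_deg S v.
  by case: (missing_deg S v) W_le => [|[|//]]; lia.
apply: alternating_even; lia || exact: deg1'.
Qed.

(** * From edge number and rainbow degree to missing edges *)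

(** Double counting: every edge at x is the image of a pair of a colour and a neighbour in that
    colour. *)
Lemma sum_color_deg : 2 * #|edges G| <= \sum_x \sum_i #|[set y | edge i x y]|.
Proof.
have -> : 2 * #|edges G| = \sum_x #|[set f in edges G | x \in f.1]|.
  rewrite mulnC -sum_nat_const.
  rewrite (eq_bigr (fun f : {set V} * 'I_2 => \sum_(x in f.1) 1)).
    rewrite (exchange_big_dep predT) //=; apply: eq_bigr => x _.
    by rewrite -sum1_card; apply: eq_bigl => f; rewrite inE.
  by move=> f fG; rewrite sum1_card (edges_loopless fG).
apply: leq_sum => x _.
have -> : \sum_i #|[set y | edge i x y]| = #|[set p : 'I_2 * V | edge p.1 x p.2]|.
  rewrite -sum1_card (eq_bigl (fun p : 'I_2 * V => edge p.1 x p.2)) => [|p].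
    rewrite -(pair_big_dep predT (fun i y => edge i x y) (fun _ _ => 1)) /=.
    by apply: eq_bigr => i _; rewrite -sum1_card; apply: eq_bigl => y; rewrite inE.
  by rewrite inE.
apply: leq_trans (leq_imset_card (fun p => ([set x; p.2], p.1)) _).
apply/subset_leq_card/subsetP => -[A i]; rewrite inE /= => /andP[fG xA].
have /eqP/cards2P[a [b [ab eA]]] := edges_loopless fG.
apply/imsetP; move: xA fG; rewrite /= in eA; rewrite eA !inE.
case/orP=> /eqP -> fG; first by exists (i, b); rewrite ?inE.
by exists (i, a); rewrite ?inE /edge /= setUC.
Qed.

Lemma missing_size_edges :
  missing_size setT + 2 * #|edges G| <= 2 * (#|V| * #|V|.-1).
Proof.
have -> : 2 * (#|V| * #|V|.-1) =
    \sum_x \sum_(i : 'I_2) (#|[set y | edge i x y]| + missing_cdeg i setT x).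
  rewrite mulnCA -sum_nat_const; apply: eq_big => [x|x _]; first by rewrite inE.
  rewrite (eq_bigr (fun=> #|V|.-1)) ?sum_nat_const ?card_ord // => i _.
  rewrite -cardsT -(edge_neighbours i (in_setT x)); congr (#|pred_of_set _| + _).
  by apply/setP => y; rewrite !inE.
under eq_bigr do rewrite big_split; rewrite big_split /= addnC leq_add //.
  exact: sum_color_deg.
by rewrite /missing_size (eq_bigl predT) // => x; rewrite inE.
Qed.

Lemma rainbow_degree_le x : rainbow_degree G <= vertex_rainbow_degree G x.
Proof.
rewrite /rainbow_degree.
elim: (index_enum V) (mem_index_enum x) => // y r IH; rewrite inE big_cons.
by case/predU1P=> [->|/IH le]; [exact: geq_minl | exact: leq_trans (geq_minr _ _) le].
Qed.

Lemma rainbow_missing_cdeg : rainbow_degree G = 2 ->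
  forall i x, missing_cdeg i setT x + 1 < #|[set: V]|.
Proof.
move=> rd i x; have := rainbow_degree_le x; rewrite rd /vertex_rainbow_degree.
set C := [set _ | _ in _ & _] => C2.
have /imsetP[[A j]] : i \in C.
  have /eqP -> : C == setT by rewrite eqEcard subsetT cardsT card_ord.
  by rewrite inE.
rewrite inE => /andP[/= fG xA] eij; rewrite -{j}eij in fG.
have /eqP/cards2P[a [b [ab eA]]] := edges_loopless fG; rewrite /= in eA.
have [y exy] : exists y, edge i x y.
  move: xA; rewrite eA in fG *; rewrite !inE => /orP[] /eqP ->.
    by exists b.
  by exists a; rewrite edgeC.
have := edge_neighbours i (in_setT x).
have : 0 < #|[set z in setT | edge i x z]|.
  by apply/card_gt0P; exists y; rewrite !inE.
have : 0 < #|[set: V]| by apply/card_gt0P; exists x; rewrite inE.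
by lia.
Qed.
End AlternatingCycles.

Theorem theorem4 (V : finType) (G : cmultigraph 2 V) (n m : nat)
    (hn : #|V| = n) (hm : #|edges G| = m) (n_ge9 : 9 <= n)
    (Gconn : connected G) (Grd : rainbow_degree G = 2)
    (m_ge : 'C(n, 2) + 'C(n - 2, 2) + 3 <= m) :
  (~~ odd n -> has_proper_hamiltonian_cycle G) /\
  (odd n -> has_proper_cycle G (n - 1)).
Proof.
have deg1 i (x : V) : x \in setT -> missing_cdeg G i setT x + 1 < #|[set: V]|.
  by move=> _; apply: rainbow_missing_cdeg.
(* Indeed 2n(n - 1) - 2m is at most n(n - 1) - (n - 2)(n - 3) - 6 = 4n - 12. *)
have WT : missing_size G setT + 12 <= 4 * #|[set: V]|.
  have := missing_size_edges G; rewrite cardsT hn hm.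
  have bin k : 2 * 'C(k, 2) = k * k.-1 by rewrite -mul_bin_diag bin1.
  move: (bin n) (bin (n - 2)) m_ge n_ge9; clear=> b1 b2 m_ge n9.
  (* Writing n as k + 3 removes the truncated subtractions. *)
  have [k ek] : exists k, k.+3 = n by exists (n - 3); lia.
  by subst n; rewrite /= in b1 b2 m_ge *; nia.
have T8 : 8 < #|[set: V]| by rewrite cardsT hn.
split=> par.
  have [||s [cyc _ sV prop]] := @alternating_proper_cycle V G setT; first by lia.
    (* The hypothesis about eight vertices is vacuous, as n is at least 9. *)
    apply: alternating_even => //; try lia.
    by rewrite cardsT hn.
  by exists s; split=> // x; rewrite sV inE.
have [|v _ alt] := @alternating_odd V G setT _ T8 WT deg1.
  by rewrite cardsT hn.
have := cardsC1 v; rewrite -setTD hn => cv.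
have [|s [cyc sz _ prop]] := alternating_proper_cycle _ alt; first by lia.
by exists s; split=> //; rewrite sz; lia.
Qed.
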